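(* Let $\{\lambda_k\}_{k\in\mathbb N}$ be the sequence of (positive) frequencies of the Hamiltonian system with Hamilton function $H(q,p)=\sum_{k=1}^{\infty}\frac{\lambda_k}{2}(p_k^2+q_k^2)$, and let $r=\{r_k\}\in\ell_2$ be a sequence of positive numbers. Then every trajectory of this Hamiltonian system on the torus $\mathbb T_r$ is periodic if and only if there are a number $\lambda_0>0$ and a sequence of natural numbers $\{n_k\}$ such that $\lambda_k=\lambda_0 n_k$ for all $k\in\mathbb N$.
   Context: The phase space is the real Hilbert space $E=Q\oplus P$ with $Q=P=\ell_2(\mathbb N,\mathbb R)$, identified with the complex space $\ell_2=\ell_2(\mathbb N,\mathbb C)$ by $z_k=q_k+ip_k$. The flow of the Hamiltonian system with frequencies $\{\lambda_k\}$ ($\lambda_k>0$) and Hamilton function $H(q,p)=\sum_k\frac{\lambda_k}{2}(p_k^2+q_k^2)$ is the group $\mathbf V_t$, $t\in\mathbb R$, given by $(\mathbf V_t z_0)_k=e^{i\lambda_k t}z_{0,k}$, $k\in\mathbb N$. The trajectory through $z_0$ is $z(t)=\mathbf V_t z_0$, $t\in\mathbb R$; it is periodic if there is $\tau>0$ with $z(t+\tau)=z(t)$ for all $t\in\mathbb R$. For a sequence $r=\{r_k\}\in\ell_2$ of positive numbers, the (non-degenerate) invariant torus is $\mathbb T_r=\{z\in\ell_2:\ |z_k|=r_k,\ k\in\mathbb N\}$. Natural numbers are the positive integers. *)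

(* Defs.v *)
From Stdlib Require Import Reals.
From Coquelicot Require Import Coquelicot.
Open Scope R_scope.

(* The index set of all sequences is [nat], so that the entry of index [k] here
   is the entry of index [k + 1] of a sequence indexed by the positive
   integers. *)

Definition real_l2 (r : nat -> R) : Prop := ex_series (fun k => (r k) ^ 2).

Definition complex_l2 (z : nat -> C) : Prop :=
  ex_series (fun k => (Cmod (z k)) ^ 2).

(* The phase space [l2] over the complex numbers, with z_k = q_k + i p_k. *)
Definition l2 : Type := {z : nat -> C | complex_l2 z}.

Definition coord (z : l2) (k : nat) : C := proj1_sig z k.

(* The complex number exp (i theta). *)
Definition expi (theta : R) : C := (cos theta, sin theta).

Lemma Cmod_expi (theta : R) : Cmod (expi theta) = 1.
Proof.
  unfold Cmod, expi; simpl.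
  rewrite !Rmult_1_r, Rplus_comm.
  change (sqrt (Rsqr (sin theta) + Rsqr (cos theta)) = 1).
  rewrite sin2_cos2; apply sqrt_1.
Qed.

Lemma complex_l2_rotate (theta : nat -> R) (z : nat -> C) :
  complex_l2 z -> complex_l2 (fun k => (expi (theta k) * z k)%C).
Proof.
  apply ex_series_ext; intro k.
  now rewrite Cmod_mult, Cmod_expi, Rmult_1_l.
Qed.

(* The flow of the Hamiltonian system with Hamilton function
   H (q, p) = sum_k lambda_k / 2 * (p_k ^ 2 + q_k ^ 2), that is, the group
   z_k |-> exp (i lambda_k t) z_k.  It is defined on all of [l2] even when
   [lambda] is unbounded and H is infinite at some points. *)
Definition flow (lambda : nat -> R) (t : R) (z0 : l2) : l2 :=
  exist complex_l2
    (fun k => (expi (lambda k * t) * coord z0 k)%C)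
    (complex_l2_rotate (fun k => lambda k * t) (coord z0) (proj2_sig z0)).

Definition trajectory (lambda : nat -> R) (z0 : l2) : R -> l2 :=
  fun t => flow lambda t z0.

Definition periodic (z : R -> l2) : Prop :=
  exists tau : R, 0 < tau /\ forall t : R, z (t + tau) = z t.

Definition torus (r : nat -> R) (z : l2) : Prop :=
  forall k : nat, Cmod (coord z k) = r k.

(* Main.v *)
Require Import Defs.
From Stdlib Require Import Reals ZArith Lra Lia.
From Stdlib Require Import ClassicalEpsilon FunctionalExtensionality ProofIrrelevance.
From Coquelicot Require Import Coquelicot.
Open Scope R_scope.

(** A period [tau] of the single trajectory through [r] itself satisfies
    exp (i lambda_k tau) = 1 for every k, because all r_k are nonzero; hence each
    lambda_k is a positive integer multiple of 2 pi / tau.  Conversely,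
    2 pi / lambda0 is a common period of all the coordinates. *)

(** Since cos x = 1 - 2 sin(x/2)^2, the sine of x/2 vanishes, so x/2 is an integer multiple of pi;
    positivity of x makes that integer positive. *)
Lemma cos_eq_1_pos (x : R) :
  0 < x -> cos x = 1 -> exists n : nat, (0 < n)%nat /\ x = 2 * INR n * PI.
Proof.
  intros x_pos cos_x.
  assert (sin_half : sin (x / 2) = 0).
  { pose proof (cos_2a_sin (x / 2)) as E.
    replace (2 * (x / 2)) with x in E by field.
    nra. }
  destruct (sin_eq_0_0 _ sin_half) as [m Hm].
  pose proof PI_RGT_0 as PI_pos.
  assert (m_pos : (0 < m)%Z) by (apply lt_IZR; nra).
  exists (Z.to_nat m); split; [lia |].
  rewrite INR_IZR_INZ, Z2Nat.id by lia.
  lra.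
Qed.

Lemma expi_period (x : R) (n : nat) : expi (x + 2 * INR n * PI) = expi x.
Proof. unfold expi; now rewrite cos_period, sin_period. Qed.

(** The summability proofs carried by [z] and [w] are identified by proof irrelevance, so the
    equality in [periodic] can be checked coordinatewise. *)
Lemma l2_ext (z w : l2) : (forall k, coord z k = coord w k) -> z = w.
Proof.
  destruct z as [z Hz], w as [w Hw]; simpl; intro E.
  now apply subset_eq_compat, functional_extensionality.
Qed.

Lemma torus_inhabited (r : nat -> R) :
  real_l2 r -> (forall k, 0 <= r k) ->
  exists z : l2, torus r z /\ forall k, coord z k = RtoC (r k).
Proof.
  intros r_l2 r_nonneg.
  assert (Cmod_r : forall k, Cmod (RtoC (r k)) = r k).
  { intro k; rewrite Cmod_R; now apply Rabs_pos_eq. }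
  assert (z_l2 : complex_l2 (fun k => RtoC (r k))).
  { revert r_l2; apply ex_series_ext; intro k; now rewrite Cmod_r. }
  now exists (exist complex_l2 _ z_l2).
Qed.

(** At time 0 the flow is the identity, so coordinate [k] is fixed by the factor
    [expi (lambda k * tau)]; dividing by this nonzero coordinate leaves 1. *)
Lemma expi_eq_1_of_period (lambda : nat -> R) (z0 : l2) (tau : R) (k : nat) :
  coord z0 k <> 0%C ->
  trajectory lambda z0 (0 + tau) = trajectory lambda z0 0 ->
  expi (lambda k * tau) = 1%C.
Proof.
  intros z0_neq0 E.
  apply (f_equal (fun z => coord z k)) in E; simpl in E.
  rewrite Rplus_0_l, Rmult_0_r in E.
  apply (f_equal (fun c => c / coord z0 k)%C) in E.
  replace (expi 0) with (RtoC 1) in E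
    by (unfold expi; now rewrite cos_0, sin_0).
  unfold Cdiv in E.
  now rewrite <- !Cmult_assoc, Cinv_r, !Cmult_1_r in E.
Qed.

Theorem theorem2 (lambda : nat -> R) (lambda_pos : forall k : nat, 0 < lambda k)
  (r : nat -> R) (r_l2 : real_l2 r) (r_pos : forall k : nat, 0 < r k) :
  (forall z0 : l2, torus r z0 -> periodic (trajectory lambda z0)) <->
  (exists (lambda0 : R) (n : nat -> nat),
      0 < lambda0 /\
      (forall k : nat, (0 < n k)%nat) /\
      (forall k : nat, lambda k = lambda0 * INR (n k))).
Proof.
  pose proof PI_RGT_0 as PI_pos.
  split.
  - intro all_periodic.
    destruct (torus_inhabited r r_l2 (fun k => Rlt_le _ _ (r_pos k)))
      as [z0 [z0_torus z0_coord]].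
    destruct (all_periodic z0 z0_torus) as [tau [tau_pos period]].
    assert (multiple : forall k, exists m : nat,
               (0 < m)%nat /\ lambda k * tau = 2 * INR m * PI).
    { intro k; apply cos_eq_1_pos.
      - now apply Rmult_lt_0_compat.
      - assert (z0_neq0 : coord z0 k <> 0%C).
        { rewrite z0_coord; intro E; apply RtoC_inj in E.
          specialize (r_pos k); lra. }
        (* The real part of exp(i lambda_k tau) = 1 is the required cosine equation. *)
        exact (f_equal fst
                 (expi_eq_1_of_period lambda z0 tau k z0_neq0 (period 0))). }
    exists (2 * PI / tau).
    (* The multiplier is only known to exist for each [k] separately; choice turns these into one
       sequence. *)
    exists (fun k => proj1_sig (constructive_indefinite_description _ (multiple k))).
    split; [apply Rdiv_lt_0_compat; lra |].
    split; intro k;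
      destruct (constructive_indefinite_description _ (multiple k))
        as [m [m_pos Hm]]; simpl; [exact m_pos |].
    replace (lambda k) with (lambda k * tau / tau) by (field; lra).
    rewrite Hm; field; lra.
  - intros [lambda0 [n [lambda0_pos [_ lambda_n]]]] z0 _.
    exists (2 * PI / lambda0).
    split; [apply Rdiv_lt_0_compat; lra |].
    intro t; apply l2_ext; intro k; simpl.
    (* Over the time 2 pi / lambda0, coordinate [k] makes exactly [n k] full turns. *)
    replace (lambda k * (t + 2 * PI / lambda0))
      with (lambda k * t + 2 * INR (n k) * PI)
      by (rewrite lambda_n; field; lra).
    now rewrite expi_period.
Qed.
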